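(* Let $d\ge 1$ and $r\in[2,\infty)$. Let $(\mathbf X_t)_{t\ge0}$ be a stationary random walk Metropolis--Hastings (RWMH) chain on $\mathbb R^d$ with target density $\pi$ and proposal step-density $\phi$ (both with respect to Lebesgue measure). If $\mathbf X_0\in L^r$, then for any $\mathbf m\in\mathbb R^d$, $$\mathbb E\|\mathbf X_1-\mathbf X_0\|^r<2^{r-1}\,\mathbb E\|\mathbf X_0-\mathbf m\|^r.$$
   Context: RWMH chain: $\pi$ and $\phi$ are probability densities on $\mathbb R^d$ with respect to Lebesgue measure, with no further conditions. Set $q(\mathbf x,\mathbf y)=\phi(\mathbf y-\mathbf x)$ and $$\alpha(\mathbf x,\mathbf y)=\begin{cases}\min\{1,\ \pi(\mathbf y)q(\mathbf y,\mathbf x)/(\pi(\mathbf x)q(\mathbf x,\mathbf y))\},&\pi(\mathbf x)q(\mathbf x,\mathbf y)>0,\\ 1,&\pi(\mathbf x)q(\mathbf x,\mathbf y)=0.\end{cases}$$ From state $\mathbf x$, the Markov chain proposes $\mathbf y$ drawn from the density $q(\mathbf x,\cdot)$, moves to $\mathbf y$ with probability $\alpha(\mathbf x,\mathbf y)$, and otherwise stays at $\mathbf x$. The chain is stationary: $\mathbf X_0$ (hence every $\mathbf X_t$) has density $\pi$. No irreducibility is assumed. $\|\cdot\|$ is the Euclidean norm, and $\mathbf X_0\in L^r$ means $\mathbb E\|\mathbf X_0\|^r<\infty$. *)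

(* Defs.v *)
From HB Require Import structures.
From mathcomp Require Import all_boot all_order all_algebra.
From mathcomp Require Import all_classical all_reals all_analysis.

Set Implicit Arguments.
Unset Strict Implicit.
Unset Printing Implicit Defensive.
Import Order.TTheory GRing.Theory Num.Theory.
Import numFieldNormedType.Exports.

Local Open Scope classical_set_scope.
Local Open Scope ring_scope.

(* MathComp-Analysis puts no sigma-algebra on matrices: row vectors get the
   one generated by the coordinate maps, i.e. the Borel sigma-algebra of R^n,
   as the library does for n.-tuple R. *)
Definition rV_display : measure_display.
Proof. exact: default_measure_display. Qed.

Section measurable_rV.
Context {R : realType}.
Variable n : nat.

Let coor (i : 'I_n) (v : 'rV[R]_n) : measurableTypeR R := v ord0 i.

Let rV_set0 : g_sigma_preimage coor set0.
Proof. exact: sigma_algebra0. Qed.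

Let rV_setC A : g_sigma_preimage coor A -> g_sigma_preimage coor (~` A).
Proof. exact: sigma_algebraC. Qed.

Let rV_bigcup (F : (set 'rV[R]_n)^nat) :
  (forall i, g_sigma_preimage coor (F i)) ->
  g_sigma_preimage coor (\bigcup_i (F i)).
Proof. exact: sigma_algebra_bigcup. Qed.

HB.instance Definition _ := @isMeasurable.Build rV_display
  'rV[R]_n (g_sigma_preimage coor) rV_set0 rV_setC rV_bigcup.

End measurable_rV.

Section lebesgue_rV.
Context {R : realType}.

Lemma measurable_coord n (i : 'I_n) :
  measurable_fun [set: 'rV[R]_n] (fun v : 'rV[R]_n => v ord0 i).
Proof.
move=> _ Y mY; rewrite setTI; apply: sub_sigma_algebra => /=.
rewrite -bigcup_seq/=; exists i => /=; first by rewrite mem_index_enum.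
by exists Y => //; rewrite setTI.
Qed.

Lemma measurable_fun_rVP d (T : measurableType d) n (f : T -> 'rV[R]_n) :
  (forall i, measurable_fun [set: T] (fun t => f t ord0 i)) ->
  measurable_fun [set: T] f.
Proof.
move=> mf _ Y mY; rewrite setTI.
suff : measurable `<=` [set A | measurable (f @^-1` A)] by exact.
apply: smallest_sub.
  split => /=; first by rewrite preimage_set0.
    by move=> A mA; rewrite setTD -preimage_setC; exact: measurableC.
  by move=> F mF; rewrite preimage_bigcup; exact: bigcup_measurable.
rewrite -bigcup_seq; apply: bigcup_sub => i _ _ [B mB <-] /=.
rewrite setTI -[X in measurable X]setTI.
exact: mf.
Qed.

Definition rV_cons n (x : measurableTypeR R * 'rV[R]_n) : 'rV[R]_n.+1 :=
  row_mx (const_mx x.1 : 'rV[R]_1) x.2.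

Definition rV_uncons n (v : 'rV[R]_n.+1) : measurableTypeR R * 'rV[R]_n :=
  (v ord0 ord0, \row_i v ord0 (lift ord0 i)).

Lemma rV_cons0 n (x : measurableTypeR R * 'rV[R]_n) :
  rV_cons x ord0 ord0 = x.1.
Proof. by rewrite /rV_cons mxE; case: splitP => // j _; rewrite mxE. Qed.

Lemma rV_consS n (x : measurableTypeR R * 'rV[R]_n) i :
  rV_cons x ord0 (lift ord0 i) = x.2 ord0 i.
Proof.
rewrite /rV_cons mxE; case: splitP => j /=; first by rewrite (ord1 j).
by rewrite /bump /= !add1n => -[ij]; congr (x.2 _ _); exact: val_inj.
Qed.

Lemma rV_consK n : cancel (@rV_cons n) (@rV_uncons n).
Proof.
move=> [a v]; rewrite /rV_uncons rV_cons0; congr pair.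
by apply/rowP => i; rewrite mxE rV_consS.
Qed.

Lemma measurable_rV_cons n : measurable_fun [set: _] (@rV_cons n).
Proof.
apply: measurable_fun_rVP => i; have [j ->|->] := unliftP ord0 i.
  rewrite (_ : (fun _ => _) = (fun v : 'rV[R]_n => v ord0 j) \o snd).
    by apply: measurableT_comp => //; exact: measurable_coord.
  by apply/funext => x; rewrite rV_consS.
by rewrite (_ : (fun _ => _) = fst)//; apply/funext => x; rewrite rV_cons0.
Qed.

Lemma measurable_rV_uncons n : measurable_fun [set: _] (@rV_uncons n).
Proof.
apply: measurable_fun_pair; first exact: measurable_coord.
apply: measurable_fun_rVP => i.
rewrite (_ : (fun _ => _) = fun v : 'rV[R]_n.+1 => v ord0 (lift ord0 i)).
  exact: measurable_coord.
by apply/funext => v; rewrite mxE.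
Qed.

Section lebesgue_cons.
Context n (mu : {sigma_finite_measure set 'rV[R]_n -> \bar R}).

Definition lebesgue_cons : set 'rV[R]_n.+1 -> \bar R := 
  pushforward (@lebesgue_measure R \x mu)%E (@rV_cons n).

Let mcons := @measurable_rV_cons n.

Let lebesgue_cons0 : lebesgue_cons set0 = 0%E.
Proof. by apply: measure0 => //; exact: mcons. Qed.

Let lebesgue_cons_ge0 A : (0 <= lebesgue_cons A)%E.
Proof. by apply: measure_ge0 => //; exact: mcons. Qed.

Let lebesgue_cons_sigma_additive : semi_sigma_additive lebesgue_cons.
Proof. by apply: measure_semi_sigma_additive => //; exact: mcons. Qed.

HB.instance Definition _ := isMeasure.Build _ _ _ lebesgue_cons
  lebesgue_cons0 lebesgue_cons_ge0 lebesgue_cons_sigma_additive.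

Let sigma_finite_lebesgue_cons : sigma_finite setT lebesgue_cons.
Proof.
have /sigma_finiteP[F [FT ndF Foo]] := sigma_finiteT (@lebesgue_measure R).
have /sigma_finiteP[G [GT ndG Goo]] := sigma_finiteT mu.
exists (fun k => @rV_uncons n @^-1` (F k `*` G k)).
  rewrite -preimage_bigcup (_ : \bigcup_k _ = setT) ?preimage_setT//.
  rewrite -subTset => -[x y] _.
  have [i _ Fix] : (\bigcup_i F i) x by rewrite -FT.
  have [j _ Gjy] : (\bigcup_j G j) y by rewrite -GT.
  exists (maxn i j) => //; split => /=.
  - by move: x Fix; exact/subsetPset/ndF/leq_maxl.
  - by move: y Gjy; exact/subsetPset/ndG/leq_maxr.
move=> k; have [mF Fk] := Foo k; have [mG Gk] := Goo k; split.
  rewrite -[X in measurable X]setTI; apply: measurable_rV_uncons => //.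
  exact: measurableX.
rewrite /lebesgue_cons /pushforward -comp_preimage.
rewrite (_ : _ \o _ = id); last by apply/funext => x; exact: rV_consK.
by rewrite preimage_id product_measure1E// lte_mul_pinfty// ge0_fin_numE.
Qed.

HB.instance Definition _ :=
  @Measure_isSigmaFinite.Build _ _ _ lebesgue_cons sigma_finite_lebesgue_cons.

End lebesgue_cons.

(* Lebesgue measure on R^n, as the n-fold product of Lebesgue measure on R *)
Fixpoint lebesgue_rV n : {sigma_finite_measure set 'rV[R]_n -> \bar R} :=
  match n with
  | 0 => \d_(0 : 'rV[R]_0)
  | n'.+1 => lebesgue_cons (lebesgue_rV n')
  end.

(* Boxes generate the sigma-algebra and are stable under intersection, so this
   characterizes [lebesgue_rV n]. *)
Lemma lebesgue_rV_box n (a b : 'rV[R]_n) :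
  (forall i, a ord0 i <= b ord0 i) ->
  lebesgue_rV n
    [set v : 'rV[R]_n | forall i, a ord0 i <= v ord0 i <= b ord0 i] =
  (\prod_(i < n) (b ord0 i - a ord0 i))%:E.
Proof.
elim: n => [|n IHn] in a b * => ab.
  rewrite /= diracE big_ord0 mem_set//.
  by move=> -[].
pose tl (v : 'rV[R]_n.+1) : 'rV[R]_n := \row_i v ord0 (lift ord0 i).
pose box := [set v : 'rV[R]_n |
  forall i, tl a ord0 i <= v ord0 i <= tl b ord0 i].
have mbox : measurable box.
  rewrite (_ : box = \bigcap_i
      [set v : 'rV[R]_n | tl a ord0 i <= v ord0 i <= tl b ord0 i]); last first.
    by apply/seteqP; split => [v bv i _|v bv i]; [exact: bv|exact: bv].
  apply: fin_bigcap_measurable; first exact: finite_finset.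
  move=> i _; rewrite -[X in measurable X]setTI.
  rewrite (_ : [set v | _] =
    (fun v : 'rV[R]_n => v ord0 i) @^-1` `[tl a ord0 i, tl b ord0 i]%classic).
    by apply: measurable_coord => //; exact: measurable_itv.
  by apply/seteqP; split=> v /=; rewrite in_itv.
rewrite /= /lebesgue_cons /pushforward.
rewrite (_ : _ @^-1` _ = `[a ord0 ord0, b ord0 ord0]%classic `*` box); last first.
  apply/seteqP; split => [x /= H|x /= [H1 H2] i].
    split; first by rewrite in_itv /= -[x.1]rV_cons0; exact: H.
    by move=> i; rewrite !mxE -[x.2 _ _]rV_consS; exact: H.
  have [j ->|->] := unliftP ord0 i.
    by rewrite rV_consS; have := H2 j; rewrite !mxE.
  by rewrite rV_cons0; move: H1; rewrite in_itv.
rewrite product_measure1E// IHn; last by move=> i; rewrite !mxE.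
rewrite big_ord_recl EFinM; congr (_ * _)%E; last first.
  by congr EFin; apply: eq_bigr => i _; rewrite !mxE.
apply: etrans (lebesgue_measure_itv `[a ord0 ord0, b ord0 ord0]) _.
rewrite /= lte_fin; case: ltgtP (ab ord0) => // -> _.
by rewrite subrr.
Qed.

End lebesgue_rV.

Arguments lebesgue_rV {R} n.

(* The norm [`|x|] of the library on 'rV[R]_n is the sup norm. *)
Definition euclidean_norm (R : realType) (n : nat) (x : 'rV[R]_n) : R :=
  Num.sqrt (\sum_(i < n) x ord0 i ^+ 2).

Definition is_density (R : realType) (d : nat) (f : 'rV[R]_d -> R) : Prop :=
  [/\ measurable_fun [set: 'rV[R]_d] f,
      forall x, 0 <= f x
    & (\int[lebesgue_rV d]_x (f x)%:E = 1)%E].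

(* [B] belongs to the sigma-algebra generated by X_0, ..., X_t. *)
Definition past (T : Type) (dE : measure_display) (E : measurableType dE)
    (X : nat -> T -> E) (t : nat) : set (set T) :=
  <<s \bigcup_(s in [set s : nat | (s <= t)%N])
        preimage_set_system [set: T] (X s) measurable >>.

(* P(X_(t+1) \in A | X_0, ..., X_t) = K(X_t, A), written out with the
   definition of conditional probability. *)
Definition markov_chain (R : realType) (dT dE : measure_display)
    (T : measurableType dT) (E : measurableType dE) (P : probability T R)
    (K : E -> set E -> \bar R) (X : nat -> {RV P >-> E}) : Prop :=
  forall (t : nat) (B : set T) (A : set E),
    past (fun s => X s : T -> E) t B -> measurable A ->
    (P (B `&` X t.+1 @^-1` A) = \int[P]_(w in B) K (X t w) A)%E.

Section RWMH.
Context {R : realType} {d : nat}.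
Variables pi phi : 'rV[R]_d -> R.
Implicit Types (x y : 'rV[R]_d) (A : set 'rV[R]_d).

Definition rw_proposal x y : R := phi (y - x).

Definition mh_acceptance x y : R :=
  if 0 < pi x * rw_proposal x y
  then Num.min 1 ((pi y * rw_proposal y x) / (pi x * rw_proposal x y))
  else 1.

(* Transition probability from [x] to [A]: given the proposal [y], the next
   state is [y] with probability [mh_acceptance x y] and [x] otherwise. *)
Definition rwmh_kernel x A : \bar R :=
  (\int[lebesgue_rV d]_y
    (rw_proposal x y * (mh_acceptance x y * \1_A y
                        + (1 - mh_acceptance x y) * \1_A x))%:E)%E.

Definition stationary_rwmh (dT : measure_display) (T : measurableType dT)
    (P : probability T R) (X : nat -> {RV P >-> 'rV[R]_d}) : Prop :=
  (forall A, measurable A ->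
    (distribution P (X 0%N) A = \int[lebesgue_rV d]_(x in A) (pi x)%:E)%E) /\
  markov_chain rwmh_kernel X.

End RWMH.

(* Main.v *)
From HB Require Import structures.
Require Import Defs.
From mathcomp Require Import all_boot all_order all_algebra.
From mathcomp Require Import all_classical all_reals all_analysis.
From mathcomp Require Import measurable_realfun.
From mathcomp Require Import ring lra.

(** The chain moves from x to y <> x with joint density
      pi x * q x y * alpha x y = min (pi x * q x y) (pi y * q y x)
    ([mh_acceptance_flux]), so with y = x + z the left-hand side of the theorem
    is the integral over the increment z of ||z||^r times the flow
      \int min (phi z * pi x) (phi (- z) * pi (x + z)) dx.
    Write M for E ||X_0 - m||^r.  Bounding ||z||^r crudely by
    2^(r-1) (||x||^r + ||x + z||^r) loses a factor 2, and the whole point is to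
    recover it by fixing z and looking at all the points of R^d at once.

    Fix z <> 0 and put a = phi z, b = phi (- z), C = (a + b) 2^r / 4.  Let s x
    be the coordinate of x - m along z, in units of ||z||, so that
    s (x + z) = s x + 1.  Think of each pair (x, x + z) as an edge, which
    carries the flow min (a pi x) (b pi (x + z)), and give each point x the
    budget C |s x|^r pi x.  A point has two edges but spends its budget on only
    one of them, the one that leads towards the hyperplane s = 0 (on the
    hyperplane the budget is 0).  Every edge is paid for:
    - an edge that does not cross the hyperplane is paid by an end point with
      |s| >= 1, hence a budget at least C pi, and C exceeds both a and b;
    - an edge that crosses it, with |s x| + |s (x + z)| = 1, is paid by both its
      end points, and this suffices because (t, c) |-> t^r / c is midpoint
      convex when r >= 2 ([powR_split]).
    Integrating over x, translation invariance of Lebesgue measure makes the two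
    halves of the budget add up to C \int |s x|^r pi x dx, and
    ||z||^r |s x|^r <= ||x - m||^r.  Hence ||z||^r times the flow is at most
    (a + b) (2^r / 4) M, and the integral over z of a + b is 2.

    Strictness holds already for each z: the payment is exact for a single
    value of s only, hyperplanes are null, and so the flow falls short of the
    budget almost everywhere where the budget is not zero
    ([edge_weights], [pair_flow_lt]).  This argument needs M < +oo; when M is
    infinite, the bound for m = 0 shows that the left-hand side is finite.

    The remaining work is to obtain the law of (X_0, X_1) on all measurable sets
    from the Markov property, which gives it on rectangles
    ([ge0_integral_rwmh_step]). *)

Set Implicit Arguments.
Unset Strict Implicit.
Unset Printing Implicit Defensive.

Import Order.TTheory GRing.Theory Num.Theory.
Import numFieldNormedType.Exports.

Local Open Scope classical_set_scope.
Local Open Scope ring_scope.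

(** * Strict comparison of integrals, and measures with a density *)

(** If the integrals agreed, [g - f] would vanish almost everywhere, which is
    possible only where [g] itself vanishes, so that [g] would have integral
    zero.  The hypothesis is restricted to the points where [g] is not zero
    because the flows below are compared with budgets that may vanish. *)
Lemma ge0_lt_integral (d : measure_display) (T : measurableType d)
    (R : realType) (mu : {measure set T -> \bar R}) (f g : T -> \bar R) :
  measurable_fun setT f -> measurable_fun setT g ->
  (forall x, 0 <= f x)%E -> (forall x, 0 <= g x)%E ->
  (forall x, f x <= g x)%E ->
  {ae mu, forall x, g x != 0%E -> (f x < g x)%E} ->
  (0 < \int[mu]_x g x < +oo)%E ->
  (\int[mu]_x f x < \int[mu]_x g x)%E.
Proof.
move=> mf mg f0 g0 fg aefg /andP[ig0 igoo].
rewrite ltNge; apply/negP => gf.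
have E : (\int[mu]_x f x = \int[mu]_x g x)%E.
  by apply/eqP; rewrite eq_le gf andbT; exact: ge0_le_integral.
have intg : mu.-integrable setT g.
  by apply/integrableP; split => //; under eq_integral do rewrite gee0_abs//.
have intf : mu.-integrable setT f.
  apply/integrableP; split => //; under eq_integral do rewrite gee0_abs//.
  by rewrite E.
have : (\int[mu]_x `|(g \- f) x| = 0)%E.
  have := integralB measurableT intg intf.
  rewrite E subee; last first.
    by rewrite ge0_fin_numE// integral_ge0.
  move=> <-.
  have := integrable_ae measurableT intg => aeg.
  apply: ae_eq_integral => //.
  - apply: measurableT_comp => //; exact: emeasurable_funB.
  - exact: emeasurable_funB.
  - apply: filterS aeg => x /(_ I) gfin _.
    by rewrite gee0_abs//= sube_ge0 ?fg// gfin orbT.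
move/ae_eq_integral_abs => /(_ measurableT (emeasurable_funB mg mf)) H.
have : ae_eq mu setT g (cst 0%E).
  apply: filterS2 aefg H => x lt_fg /(_ I)/= gf0 _ /=.
  apply/eqP; apply: contraT => /lt_fg; rewrite -sube_gt0 gf0 ltxx//.
move/(ge0_ae_eq_integral measurableT mg (@measurable_cst _ _ _ _ _ _)).
move=> /(_ (fun x _ => g0 x) (fun x _ => lexx 0%E)) => ig.
by move: ig0; rewrite ig integral0 ltxx.
Qed.

Lemma integral_mul_gt0 d (T : measurableType d) (R : realType)
    (mu : {measure set T -> \bar R}) (f g : T -> R) :
  measurable_fun [set: T] f -> measurable_fun [set: T] g ->
  (forall x, 0 <= f x) -> (forall x, 0 <= g x) ->
  {ae mu, forall x, g x != 0} -> (0 < \int[mu]_x (f x)%:E)%E ->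
  (0 < \int[mu]_x (g x * f x)%:E)%E.
Proof.
move=> mf mg f0 g0 aeg if0.
have gf0 x : (0 <= (g x * f x)%:E)%E by rewrite lee_fin mulr_ge0.
rewrite lt_neqAle eq_sym integral_ge0// andbT; apply/eqP => igf.
have mgf : measurable_fun [set: T] (fun x => (g x * f x)%:E).
  by apply/measurable_EFinP; exact: measurable_funM.
have : ae_eq mu setT (fun x => (f x)%:E) (cst 0%E).
  have : (\int[mu]_x `|(g x * f x)%:E| = 0)%E.
    by rewrite -[RHS]igf; apply: eq_integral => x _; rewrite gee0_abs.
  move/(ae_eq_integral_abs _ measurableT mgf); apply: filterS2 aeg => x gx.
  move=> /(_ I)/= [] /eqP; rewrite mulf_eq0 (negbTE gx)/= => /eqP fx _.
  by rewrite fx.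
move/(ge0_ae_eq_integral measurableT); rewrite integral0.
have mfE : measurable_fun [set: T] (EFin \o f) by exact/measurable_EFinP.
move=> /(_ mfE (@measurable_cst _ _ _ _ _ _)) H.
by move: if0; rewrite H ?ltxx// => x _ /=; rewrite lee_fin.
Qed.

Section density.
Context (d : measure_display) (T : measurableType d) (R : realType).
Variables (mu : {measure set T -> \bar R}) (g : T -> R).
Hypotheses (mg : measurable_fun [set: T] g) (g0 : forall x, 0 <= g x).

(** The proofs are arguments so that a density carries its measure structure,
    whatever the context. *)
Definition density of measurable_fun [set: T] g & (forall x, 0 <= g x) :=
  fun A : set T => (\int[mu]_(x in A) (g x)%:E)%E.

Local Notation nu := (density mg g0).

Let nu_set0 : nu set0 = 0%E. Proof. exact: integral_set0. Qed.

Let nu_ge0 A : (0 <= nu A)%E.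
Proof. by apply: integral_ge0 => x _; rewrite lee_fin. Qed.

Let nu_semi_sigma_additive : semi_sigma_additive nu.
Proof.
apply: semi_sigma_additive_nng_induced; first exact/measurable_EFinP.
by move=> x; rewrite lee_fin.
Qed.

HB.instance Definition _ :=
  isMeasure.Build _ _ _ nu nu_set0 nu_ge0 nu_semi_sigma_additive.

Import HBNNSimple.

(** By monotone convergence from the simple functions. *)
Lemma ge0_integral_density (f : T -> \bar R) :
  measurable_fun [set: T] f -> (forall x, 0 <= f x)%E ->
  (\int[nu]_x f x = \int[mu]_x ((g x)%:E * f x))%E.
Proof.
move=> mf f0; pose h := nnsfun_approx measurableT mf.
have hcvg x : (h n x)%:E @[n --> \oo] --> f x.
  by apply: cvg_nnsfun_approx => // y _; exact: f0.
have mgE : measurable_fun [set: T] (fun x => (g x)%:E) by exact/measurable_EFinP.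
transitivity (limn (fun n => \int[nu]_x (h n x)%:E))%E.
  rewrite -monotone_convergence//.
  - by apply: eq_integral => x _; apply/esym/cvg_lim => //; exact: hcvg.
  - by move=> n; exact/measurable_EFinP.
  - by move=> n x _; rewrite lee_fin.
  - by move=> x _ a b ab; rewrite lee_fin; exact/lefP/nd_nnsfun_approx.
transitivity (limn (fun n => \int[mu]_x ((g x)%:E * (h n x)%:E)))%E; last first.
  rewrite -monotone_convergence//.
  - apply: eq_integral => x _; apply/cvg_lim => //.
    by apply: cvgeZl => //; exact: hcvg.
  - by move=> n; apply: emeasurable_funM => //; exact/measurable_EFinP.
  - by move=> n x _; rewrite mule_ge0 ?lee_fin.
  - move=> x _ a b ab; rewrite lee_wpmul2l ?lee_fin//.
    exact/lefP/nd_nnsfun_approx.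
congr (limn _); apply/funext => n.
have mhr r : measurable_fun [set: T]
    (fun x => (r * \1_(h n @^-1` [set r]) x)%:E).
  exact/measurable_EFinP/measurable_funM.
under [LHS]eq_integral do rewrite fimfunE -fsumEFin//.
rewrite ge0_integral_fsum//; last first.
  by move=> r x _; rewrite nnfun_muleindic_ge0.
under [RHS]eq_integral => x _.
  rewrite fimfunE -fsumEFin// muleC ge0_mule_fsuml => [|y]; last first.
    exact: nnfun_muleindic_ge0.
  over.
rewrite ge0_integral_fsum//; last 2 first.
  - by move=> r; exact: emeasurable_funM.
  - by move=> r x _; rewrite mule_ge0 ?nnfun_muleindic_ge0 ?lee_fin.
apply: eq_fsbigr => r /set_mem[x _ <-].
rewrite integralZl_indic_nnsfun// integral_indic// setIT.
under [RHS]eq_integral do rewrite EFinM -muleA.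
rewrite ge0_integralZl//=; last 3 first.
  - by apply: emeasurable_funM => //; exact/measurable_EFinP.
  - by move=> y _; rewrite mule_ge0 ?lee_fin.
  - by rewrite lee_fin.
congr (_ * _)%E; rewrite /nu /density integral_mkcond.
by apply: eq_integral => y _; rewrite epatch_indic muleC.
Qed.

End density.

(** * Symmetries and null sets of Lebesgue measure on R^n *)

Section lebesgue_rV_invariance.
Context {R : realType}.

(** Peels off the first coordinate; the facts on R^n below follow by induction
    on n from this and the case of the line. *)
Lemma ge0_integral_rV_cons n (f : 'rV[R]_n.+1 -> \bar R) :
  measurable_fun [set: 'rV[R]_n.+1] f -> (forall v, 0 <= f v)%E ->
  (\int[lebesgue_rV n.+1]_v f v =
   \int[@lebesgue_measure R]_a \int[lebesgue_rV n]_v f (rV_cons (a, v)))%E.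
Proof.
move=> mf f0.
have -> : (\int[lebesgue_rV n.+1]_v f v =
   \int[pushforward (@lebesgue_measure R \x lebesgue_rV n)%E (@rV_cons R n)]_v f v)%E by [].
rewrite ge0_integral_pushforward//; last exact: measurable_rV_cons.
rewrite preimage_setT fubini_tonelli1//.
  by apply: measurableT_comp => //; exact: measurable_rV_cons.
by move=> x; exact: f0.
Qed.

Lemma measurable_fun_rV_cons n (f : 'rV[R]_n.+1 -> \bar R) :
  measurable_fun [set: 'rV[R]_n.+1] f ->
  measurable_fun [set: measurableTypeR R * 'rV[R]_n] (f \o @rV_cons R n).
Proof. by move=> mf; apply: measurableT_comp => //; exact: measurable_rV_cons. Qed.

(** Reflections rather than translations are the basic symmetry: a translation
    is the composite of two reflections, and both are needed. *)
Lemma ge0_integral_lebesgue_reflection (c : R) (f : measurableTypeR R -> \bar R) :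
  measurable_fun [set: measurableTypeR R] f -> (forall x, 0 <= f x)%E ->
  (\int[@lebesgue_measure R]_x f (c - x)%R = \int[@lebesgue_measure R]_x f x)%E.
Proof.
move=> mf f0; pose h (x : measurableTypeR R) : measurableTypeR R := c - x.
have mh : measurable_fun [set: measurableTypeR R] h.
  exact: measurable_funB.
pose hm : {mfun measurableTypeR R >-> measurableTypeR R} :=
  HB.pack h (isMeasurableFun.Build _ _ _ _ _ mh).
transitivity (\int[pushforward (@lebesgue_measure R) hm]_x f x)%E.
  by rewrite (ge0_integral_pushforward mh).
apply: eq_measure_integral => A mA _; apply/esym/lebesgue_measure_unique => //.
move=> _ [[a b] _ <-]; transitivity (@lebesgue_measure R `[c - b, c - a[%classic).
  rewrite !lebesgue_measure_itv/= !lte_fin ltrD2l ltrN2.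
  by case: ifP => // _; rewrite -!EFinB opprB [in RHS]addrC addrA subrK.
congr lebesgue_measure; apply/seteqP; split => x; rewrite /h /= !in_itv/=.
  by rewrite lerBlDr -lerBlDl ltrBrDr -ltrBrDl andbC.
by rewrite lerBlDr -lerBlDl ltrBrDr -ltrBrDl andbC.
Qed.

Lemma ge0_integral_rV_reflection n (c : 'rV[R]_n) (f : 'rV[R]_n -> \bar R) :
  measurable_fun [set: 'rV[R]_n] f -> (forall x, 0 <= f x)%E ->
  (\int[lebesgue_rV n]_x f (c - x)%R = \int[lebesgue_rV n]_x f x)%E.
Proof.
elim: n => [|n IHn] in c f * => mf f0.
  by apply: eq_integral => x _; congr f; apply/rowP => -[].
have mfc : measurable_fun [set: 'rV[R]_n.+1] (fun x => f (c - x)).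
  apply: measurableT_comp => //; apply: measurable_fun_rVP => i.
  under eq_fun do rewrite !mxE.
  by apply: measurable_funB => //; exact: measurable_coord.
rewrite (ge0_integral_rV_cons mf f0) (ge0_integral_rV_cons mfc)//.
pose c' : 'rV[R]_n := \row_i c ord0 (lift ord0 i).
pose F a := (\int[lebesgue_rV n]_v f (rV_cons (a, v)))%E.
rewrite -(@ge0_integral_lebesgue_reflection (c ord0 ord0) F); last 2 first.
- apply: (measurable_fun_fubini_tonelli_F (f \o @rV_cons R n)).
    exact: measurable_fun_rV_cons.
  by move=> x; exact: f0.
- by move=> a; exact: integral_ge0.
apply: eq_integral => a _; rewrite /F -[RHS](IHn c'); last 2 first.
- exact: (measurable_fun_pair2 (c ord0 ord0 - a : measurableTypeR R)
    (measurable_fun_rV_cons mf)).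
- by move=> x.
apply: eq_integral => v _; congr f; apply/rowP => i; rewrite [LHS]mxE.
have [j ->|->] := unliftP ord0 i; first by rewrite mxE !rV_consS !mxE.
by rewrite mxE !rV_cons0.
Qed.

Lemma measurable_funD_rV d (T : measurableType d) n (f g : T -> 'rV[R]_n) :
  measurable_fun [set: T] f -> measurable_fun [set: T] g ->
  measurable_fun [set: T] (fun t => f t + g t).
Proof.
move=> mf mg; apply: measurable_fun_rVP => i; under eq_fun do rewrite mxE.
apply: measurable_funD.
  by apply: (measurableT_comp (measurable_coord i)).
by apply: (measurableT_comp (measurable_coord i)).
Qed.

Lemma measurable_funN_rV d (T : measurableType d) n (f : T -> 'rV[R]_n) :
  measurable_fun [set: T] f -> measurable_fun [set: T] (fun t => - f t).
Proof.
move=> mf; apply: measurable_fun_rVP => i; under eq_fun do rewrite mxE.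
apply: measurable_funN.
by apply: (measurableT_comp (measurable_coord i)).
Qed.

Lemma ge0_integral_rV_translation n (c : 'rV[R]_n) (f : 'rV[R]_n -> \bar R) :
  measurable_fun [set: 'rV[R]_n] f -> (forall x, 0 <= f x)%E ->
  (\int[lebesgue_rV n]_x f (x + c)%R = \int[lebesgue_rV n]_x f x)%E.
Proof.
move=> mf f0; rewrite -(ge0_integral_rV_reflection c mf)//.
rewrite -(@ge0_integral_rV_reflection n 0 (fun x => f (c - x))).
- by apply: eq_integral => x _; rewrite sub0r opprK addrC.
- apply: measurableT_comp => //; apply: measurable_funD_rV => //.
  exact: measurable_funN_rV.
- by move=> x.
Qed.

Definition dotv n (x z : 'rV[R]_n) : R := \sum_i x ord0 i * z ord0 i.

Lemma measurable_dotv n (z : 'rV[R]_n) : measurable_fun [set: 'rV[R]_n] (fun x => dotv x z).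
Proof.
apply: measurable_sum => i; apply: measurable_funM => //.
exact: measurable_coord.
Qed.

(** If the tail of [z] is not zero, every slice of the hyperplane at a fixed first
    coordinate is a hyperplane one dimension below; otherwise the hyperplane is
    a condition on the first coordinate alone. *)
Lemma lebesgue_rV_hyperplane n (z : 'rV[R]_n) (c : R) : z != 0 ->
  lebesgue_rV n [set x | dotv x z = c] = 0%E.
Proof.
elim: n => [|n IHn] in z c *; first by rewrite thinmx0 eqxx.
move=> z0.
have mH m (y : 'rV[R]_m) e : measurable [set x | dotv x y = e].
  rewrite -[X in measurable X]setTI.
  exact: (measurable_dotv y measurableT (measurable_set1 e)).
pose z' : 'rV[R]_n := \row_i z ord0 (lift ord0 i).
have dot_cons a v : dotv (rV_cons (a, v)) z = a * z ord0 ord0 + dotv v z'.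
  rewrite /dotv big_ord_recl rV_cons0; congr (_ + _).
  by apply: eq_bigr => i _; rewrite rV_consS mxE.
rewrite /= /lebesgue_cons /pushforward.
have [z'0|z'0] := eqVneq z' 0; last first.
  rewrite /= /product_measure1; apply: integral0_eq => a _ /=.
  rewrite -[RHS](IHn z' (c - a * z ord0 ord0) z'0); congr (lebesgue_rV n _).
  apply/seteqP; split => v; rewrite /xsection/= inE/= dot_cons.
    by move=> <-; rewrite addrC addKr.
  by move=> ->; rewrite addrC subrK.
have z00 : z ord0 ord0 != 0.
  apply: contra_neq z0 => z00; apply/rowP => i; rewrite mxE.
  have [j ->|->//] := unliftP ord0 i.
  by move/rowP: z'0 => /(_ j); rewrite !mxE.
rewrite (_ : _ @^-1` _ = [set c / z ord0 ord0] `*` setT).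
  rewrite product_measure1E// -[RHS](mul0e (lebesgue_rV n setT)).
  by congr (_ * _)%E; exact: lebesgue_measure_set1.
have dot0 v : dotv v z' = 0.
  by rewrite /dotv big1// => i _; rewrite z'0 mxE mulr0.
apply/seteqP; split => -[a v] /=; rewrite dot_cons dot0 addr0.
  by move=> <-; rewrite mulfK.
by move=> [-> _]; rewrite divfK.
Qed.

End lebesgue_rV_invariance.

(** * Euclidean geometry *)

Section euclid.
Context {R : realType} {n : nat}.
Implicit Types x y z : 'rV[R]_n.

Lemma dotvDl x y z : dotv (x + y) z = dotv x z + dotv y z.
Proof.
by rewrite /dotv -big_split; apply: eq_bigr => i _; rewrite mxE mulrDl.
Qed.

Lemma dotv_ge0 x : 0 <= dotv x x.
Proof. by apply: sumr_ge0 => i _; rewrite -expr2 sqr_ge0. Qed.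

Lemma dotv_eq0 x : (dotv x x == 0) = (x == 0).
Proof.
apply/idP/eqP => [|->]; last by rewrite /dotv big1// => i _; rewrite mxE mul0r.
rewrite psumr_eq0 => [/allP x0|i _]; last by rewrite -expr2 sqr_ge0.
apply/rowP => i; rewrite mxE; apply/eqP.
by have := x0 i (mem_index_enum i); rewrite /= mulf_eq0 orbb.
Qed.

Lemma euclidean_normE x : euclidean_norm x = Num.sqrt (dotv x x).
Proof. by []. Qed.

Lemma euclidean_norm_ge0 x : 0 <= euclidean_norm x.
Proof. exact: sqrtr_ge0. Qed.

Lemma euclidean_norm0 : euclidean_norm (0 : 'rV[R]_n) = 0.
Proof.
have /eqP d0 : dotv (0 : 'rV[R]_n) 0 == 0 by rewrite dotv_eq0.
by rewrite euclidean_normE d0 sqrtr0.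
Qed.

Lemma euclidean_norm_gt0 x : x != 0 -> 0 < euclidean_norm x.
Proof. by move=> x0; rewrite sqrtr_gt0 lt_def dotv_ge0 dotv_eq0 x0. Qed.

(** The sum of squares of Z x_i - D z_i is Z (Z <x, x> - D^2), where Z = <z, z>
    and D = <x, z>. *)
Lemma cauchy_schwarz_dotv x z : dotv x z ^+ 2 <= dotv x x * dotv z z.
Proof.
have [->|z0] := eqVneq z 0.
  have d0 y : dotv y 0 = 0 by rewrite /dotv big1// => i _; rewrite mxE mulr0.
  by rewrite !d0 expr0n mulr0.
set Z := dotv z z; set D := dotv x z.
have Z0 : 0 < Z by rewrite lt_def dotv_ge0 dotv_eq0 z0.
have : 0 <= \sum_i (Z * x ord0 i - D * z ord0 i) ^+ 2.
  by apply: sumr_ge0 => i _; exact: sqr_ge0.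
have -> : \sum_i (Z * x ord0 i - D * z ord0 i) ^+ 2 =
    Z * (dotv x x * Z - D ^+ 2).
  transitivity (\sum_i (Z ^+ 2 * (x ord0 i * x ord0 i) -
      2 * Z * D * (x ord0 i * z ord0 i) + D ^+ 2 * (z ord0 i * z ord0 i))).
    by apply: eq_bigr => i _; ring.
  rewrite big_split sumrB -!mulr_sumr /= -/(dotv x x) -/(dotv x z).
  by rewrite -/(dotv z z) -/Z -/D; ring.
by rewrite pmulr_rge0// subr_ge0.
Qed.

(** Measured in units of the norm of [z], so that adding [z] adds 1. *)
Definition coordv x z := dotv x z / dotv z z.

Lemma coordv_le_norm x z : z != 0 ->
  euclidean_norm z * `|coordv x z| <= euclidean_norm x.
Proof.
move=> z0; have Z0 : 0 < dotv z z by rewrite lt_def dotv_ge0 dotv_eq0 z0.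
rewrite -ler_sqr ?nnegrE ?mulr_ge0 ?euclidean_norm_ge0//.
rewrite exprMn !sqr_sqrtr ?dotv_ge0// real_normK ?num_real// /coordv.
have -> : dotv z z * (dotv x z / dotv z z) ^+ 2 = dotv x z ^+ 2 / dotv z z.
  by field; rewrite gt_eqF.
by rewrite ler_pdivrMr// cauchy_schwarz_dotv.
Qed.

Lemma coordvDl x z : z != 0 -> coordv (x + z) z = coordv x z + 1.
Proof. by move=> z0; rewrite /coordv dotvDl mulrDl divff// dotv_eq0. Qed.

Lemma measurable_euclidean_norm_powR d (T : measurableType d) (f : T -> 'rV[R]_n)
    (r : R) : measurable_fun [set: T] f ->
  measurable_fun [set: T] (fun t => euclidean_norm (f t) `^ r).
Proof.
move=> mf.
under eq_fun do rewrite euclidean_normE -powR12_sqrt ?dotv_ge0// -powRrM.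
apply: (measurableT_comp (measurable_powR _)); apply: measurable_sum => i.
by apply: measurable_funM; exact: (measurableT_comp (measurable_coord i)).
Qed.

Lemma measurable_coordv z : measurable_fun [set: 'rV[R]_n] (fun x => coordv x z).
Proof. by apply: measurable_funM => //; exact: measurable_dotv. Qed.

Lemma negligible_coordv z c (m : 'rV[R]_n) : z != 0 ->
  (lebesgue_rV n).-negligible [set x | coordv (x + m) z = c].
Proof.
move=> z0; exists [set x | dotv x z = c * dotv z z - dotv m z]; split.
- rewrite -[X in measurable X]setTI.
  exact: (measurable_dotv z measurableT (measurable_set1 _)).
- exact: lebesgue_rV_hyperplane.
- by move=> x/= <-; rewrite divfK ?dotv_eq0// dotvDl addrK.
Qed.

End euclid.

(** * Paying for one edge *)

Section edge.
Context {R : realType}.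
Implicit Types a b r s x y : R.

Lemma powR_half_sqr x r : 0 <= x -> (x `^ (r / 2)) ^+ 2 = x `^ r.
Proof. by move=> x0; rewrite -powR_mulrn ?powR_ge0// -powRrM divfK. Qed.

Lemma powR_mean_le x y r : 1 <= r -> 0 <= x -> 0 <= y ->
  ((x + y) / 2) `^ r <= (x `^ r + y `^ r) / 2.
Proof.
move=> r1 x0 y0; rewrite mulrC mulrDr [leRHS]mulrC [leRHS]mulrDr.
rewrite {2 4}(_ : 2^-1 = 1 - 2^-1); last by rewrite {2}(splitr 1) div1r addrK.
by apply: (convex_powR r1 (Itv01 _ _)) => //=;
  rewrite ?inE/= ?in_itv/= ?x0 ?y0// ?invr_ge0// invf_le1 ?ler1n.
Qed.

Lemma four_le_powR2 r : 2 <= r -> 4 <= 2 `^ r :> R.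
Proof.
move=> r2; apply: le_trans (ler_powR _ r2); last by rewrite ler1n.
by rewrite powR_mulrn ?ler0n// -natrX.
Qed.

(** Midpoint convexity of (t, c) |-> t^r / c, with its defect.  Put X = x^(r/2)
    and Y = y^(r/2).  Convexity of t^(r/2), which needs r >= 2, bounds
    ((x + y) / 2)^r by ((X + Y) / 2)^2, and
    (a + b) (X^2 / a + Y^2 / b) = (X + Y)^2 + (b X - a Y)^2 / (a b). *)
Lemma powR_split a b r x y : 0 < a -> 0 < b -> 2 <= r ->
  0 <= x -> 0 <= y -> x + y = 1 ->
  1 + 2 `^ r / 4 * ((b * x `^ (r / 2) - a * y `^ (r / 2)) ^+ 2 / (a * b)) <=
  (a + b) * (2 `^ r / 4) * (x `^ r / a + y `^ r / b).
Proof.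
move=> a0 b0 r2 x0 y0 xy.
set K := 2 `^ r / 4; set X := x `^ (r / 2); set Y := y `^ (r / 2).
have K0 : 0 <= K by rewrite divr_ge0 ?powR_ge0.
have XY : 1 <= K * (X + Y) ^+ 2.
  have r21 : 1 <= r / 2 by lra.
  have := powR_mean_le r21 x0 y0; rewrite xy -/X -/Y => XY2.
  have -> : 1 = 2 `^ r * ((1 / 2) `^ (r / 2)) ^+ 2 :> R.
    by rewrite powR_half_sqr ?divr_ge0// -powRM ?divr_ge0// mulrC divfK// powR1.
  have -> : K * (X + Y) ^+ 2 = 2 `^ r * ((X + Y) / 2) ^+ 2 by rewrite /K; field.
  rewrite ler_wpM2l ?powR_ge0// ler_sqr ?nnegrE ?powR_ge0//.
  by rewrite divr_ge0 ?addr_ge0 ?powR_ge0.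
rewrite -(powR_half_sqr r x0) -(powR_half_sqr r y0) -/X -/Y.
apply: (le_trans (lerD XY (lexx _))).
rewrite le_eqVlt; apply/orP; left; apply/eqP; field.
by rewrite !gt_eqF.
Qed.

(** Locates the zero of the defect in [powR_split]. *)
Lemma powR_eq_ratio a b x y r : 0 < r -> 0 < a -> 0 < b -> 0 <= x -> 0 <= y ->
  x + y = 1 -> b * x `^ r = a * y `^ r ->
  x = a `^ r^-1 / (a `^ r^-1 + b `^ r^-1).
Proof.
move=> r0 a0 b0 x0 y0 xy /(congr1 (@powR R ^~ r^-1)).
rewrite (powRM _ (ltW b0) (powR_ge0 _ _)) (powRM _ (ltW a0) (powR_ge0 _ _)).
rewrite -!powRrM mulfV ?gt_eqF//.
rewrite !powRr1// => E.
have A0 : 0 < a `^ r^-1 by exact: powR_gt0.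
have B0 : 0 < b `^ r^-1 by exact: powR_gt0.
apply: (canRL (mulfK _)); first by rewrite gt_eqF ?addr_gt0.
by rewrite mulrDr (mulrC x (b `^ _)) E (mulrC x) -mulrDr xy mulr1.
Qed.

(** A point at coordinate [s] pays for one edge only: the one on its right if
    [s <= 0], the one on its left otherwise.  [left_weight] is what it pays as the
    left end of an edge, [right_weight] what it pays as the right end. *)
Definition left_weight (C r s : R) := if s <= 0 then C * `|s| `^ r else 0.
Definition right_weight (C r s : R) := if s <= 0 then 0 else C * `|s| `^ r.

Lemma left_weight_ge0 C r s : 0 <= C -> 0 <= left_weight C r s.
Proof.
by move=> C0; rewrite /left_weight; case: ifP; rewrite // mulr_ge0 ?powR_ge0.
Qed.

Lemma right_weight_ge0 C r s : 0 <= C -> 0 <= right_weight C r s.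
Proof.
by move=> C0; rewrite /right_weight; case: ifP; rewrite // mulr_ge0 ?powR_ge0.
Qed.

Lemma weightsD C r s : left_weight C r s + right_weight C r s = C * `|s| `^ r.
Proof.
by rewrite /left_weight /right_weight; case: ifP; rewrite ?addr0 ?add0r.
Qed.

(** Every edge, from coordinate [s] to [s + 1], is paid for.  Edges away from the
    origin are overpaid by the end point with |s| >= 1, because [a] and [b] are
    both smaller than [C]; an edge across the origin is shared, and
    [powR_split] leaves a surplus except at one position. *)
Lemma edge_weights a b r (C := (a + b) * (2 `^ r / 4)) :
  0 < a -> 0 < b -> 2 <= r ->
  exists s0, forall s,
    1 <= left_weight C r s / a + right_weight C r (s + 1) / b /\
    (s != s0 -> 1 < left_weight C r s / a + right_weight C r (s + 1) / b).
Proof.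
move=> a0 b0 r2.
have r0 : 0 < r / 2 by lra.
have K1 : 1 <= 2 `^ r / 4 :> R by rewrite ler_pdivlMr// mul1r four_le_powR2.
have Cab : a + b <= C by rewrite ler_peMr// addr_ge0// ltW.
have far c s : 0 < c -> c < C -> 1 <= `|s| -> 1 < C * `|s| `^ r / c.
  move=> c0 cC s1; rewrite ltr_pdivlMr// mul1r (lt_le_trans cC)//.
  rewrite ler_peMr ?(ltW (lt_trans c0 cC))//.
  by rewrite -(powRr0 `|s|) ler_powR//; lra.
(* where the defect in [powR_split] vanishes, by [powR_eq_ratio] *)
exists (- (a `^ (r / 2)^-1 / (a `^ (r / 2)^-1 + b `^ (r / 2)^-1))) => s.
rewrite /left_weight /right_weight.
have [s_le0|s_gt0] := leP s 0; have [s1_le0|s1_gt0] := leP (s + 1) 0.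
- have H : 1 < C * `|s| `^ r / a.
    by apply: far => //; [lra|rewrite ler0_norm//; lra].
  by rewrite mul0r addr0; split => // ; exact: ltW.
- have := powR_split a0 b0 r2.
  move=> /(_ (- s) (s + 1)); rewrite oppr_ge0 => /(_ s_le0 (ltW s1_gt0)).
  rewrite addrA addNr add0r => /(_ erefl).
  rewrite -/C (ler0_norm s_le0) (gtr0_norm s1_gt0).
  set D := _ - _; set W := C * (_ + _) => H.
  have -> : C * (- s) `^ r / a + C * (s + 1) `^ r / b = W by rewrite /W; ring.
  have ab0 : 0 < a * b by rewrite mulr_gt0.
  have K0 : 0 < 2 `^ r / 4 :> R by rewrite (lt_le_trans _ K1).
  split.
    apply: le_trans H; rewrite lerDl mulr_ge0 ?(ltW K0)//.
    by rewrite divr_ge0 ?sqr_ge0 ?ltW.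
  move=> ss0; apply: lt_le_trans H; rewrite ltrDl mulr_gt0//.
  rewrite divr_gt0// lt_def sqr_ge0 andbT sqrf_eq0 subr_eq0.
  apply: contra ss0 => /eqP E; rewrite -eqr_oppLR; apply/eqP.
  apply: powR_eq_ratio E => //; rewrite ?oppr_ge0 ?(ltW s1_gt0)//.
  by rewrite addrA addNr add0r.
- by exfalso; lra.
- have H : 1 < C * `|s + 1| `^ r / b.
    by apply: far => //; [lra|rewrite gtr0_norm//; lra].
  by rewrite mul0r add0r; split => //; exact: ltW.
Qed.

(** With [p], [q] the values of pi at the two ends of an edge, the flow is
    covered as soon as the shares [u / a] and [v / b] paid by the two ends add
    up to 1. *)
Lemma min_weights_le a b p q u v : 0 < a -> 0 < b -> 0 <= u -> 0 <= v ->
  (u / a + v / b) * Num.min (a * p) (b * q) <= u * p + v * q.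
Proof.
move=> a0 b0 u0 v0; set f := Num.min _ _.
have fp : f / a <= p by rewrite ler_pdivrMr// mulrC ge_min lexx.
have fq : f / b <= q by rewrite ler_pdivrMr// mulrC ge_min lexx orbT.
rewrite (_ : _ * f = u * (f / a) + v * (f / b)); last by ring.
by apply: lerD; apply: ler_wpM2l.
Qed.

Lemma min_le_weights a b p q u v : 0 < a -> 0 < b -> 0 <= p -> 0 <= q ->
  0 <= u -> 0 <= v -> 1 <= u / a + v / b ->
  Num.min (a * p) (b * q) <= u * p + v * q.
Proof.
move=> a0 b0 p0 q0 u0 v0 uv; apply: le_trans (min_weights_le p q a0 b0 u0 v0).
by rewrite ler_peMl// le_min !mulr_ge0 ?(ltW a0) ?(ltW b0).
Qed.

Lemma min_lt_weights a b p q u v : 0 < a -> 0 < b -> 0 <= p -> 0 <= q ->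
  0 <= u -> 0 <= v -> 1 < u / a + v / b -> u * p + v * q != 0 ->
  Num.min (a * p) (b * q) < u * p + v * q.
Proof.
move=> a0 b0 p0 q0 u0 v0 uv neq0.
have := min_weights_le p q a0 b0 u0 v0; set f := Num.min _ _.
have : 0 <= f by rewrite le_min !mulr_ge0 ?(ltW a0) ?(ltW b0).
rewrite le_eqVlt => /predU1P[<- _|f0]; last by apply: lt_le_trans; rewrite ltr_pMl.
by rewrite lt_neqAle eq_sym neq0 addr_ge0 ?mulr_ge0.
Qed.

End edge.

(** * The flow along a fixed increment *)

Section flow.
Context {R : realType} {n : nat}.
Variables (pi : 'rV[R]_n -> R).
Hypothesis hpi : is_density pi.
Local Notation L := (lebesgue_rV n).

Let mpi : measurable_fun [set: 'rV[R]_n] pi. Proof. by case: hpi. Qed.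
Let pi0 x : 0 <= pi x. Proof. by case: hpi. Qed.
Let ipi : (\int[L]_x (pi x)%:E = 1)%E. Proof. by case: hpi. Qed.

Definition directional_moment (r : R) (m z : 'rV[R]_n) : \bar R :=
  (\int[L]_x (`|coordv (x - m) z| `^ r * pi x)%:E)%E.

(** When [a = phi z] and [b = phi (- z)], this is the density at [z] of the
    increment of the chain, off the event that the chain stays put. *)
Definition pair_flow (a b : R) (z : 'rV[R]_n) : \bar R :=
  (\int[L]_x (Num.min (a * pi x) (b * pi (x + z)%R))%:E)%E.

Lemma directional_moment_gt0 (r : R) (m z : 'rV[R]_n) : z != 0 ->
  (0 < directional_moment r m z)%E.
Proof.
move=> z0; apply: integral_mul_gt0 => //; last by rewrite ipi.
- apply: (measurableT_comp (measurable_powR _)); apply: measurableT_comp => //.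
  apply: (measurableT_comp (measurable_coordv _)).
  exact: measurable_funD_rV.
- apply: negligibleS (negligible_coordv 0 (- m) z0) => x/=; apply: contra_notP => xm.
  by apply: contra_not_neq xm => /powR_eq0_eq0/normr0_eq0.
Qed.

(** Each edge is paid for by its two ends, as in [edge_weights]; translating the
    payments of the right ends by [z] collects the two payments of each point,
    which add up to its budget. *)
Lemma pair_flow_lt (a b r : R) (z m : 'rV[R]_n) :
  0 < a -> 0 < b -> 2 <= r -> z != 0 ->
  (directional_moment r m z < +oo)%E ->
  (pair_flow a b z < ((a + b) * (2 `^ r / 4))%:E * directional_moment r m z)%E.
Proof.
move=> a0 b0 r2 z0 Moo; set C := (a + b) * _.
have C0 : 0 < C by rewrite mulr_gt0 ?addr_gt0 ?divr_gt0 ?powR_gt0.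
have M0 := directional_moment_gt0 r m z0.
pose s x := coordv (x - m) z.
have ms : measurable_fun [set: 'rV[R]_n] s.
  by apply: (measurableT_comp (measurable_coordv _)); exact: measurable_funD_rV.
have sD x : s (x + z) = s x + 1 by rewrite /s addrAC coordvDl.
have mpow : measurable_fun [set: 'rV[R]_n] (fun x => `|s x| `^ r).
  by apply: (measurableT_comp (measurable_powR _)); exact: measurableT_comp.
pose U x := left_weight C r (s x) * pi x.
pose V x := right_weight C r (s x) * pi x.
have U0 x : 0 <= U x.
  by rewrite mulr_ge0 ?left_weight_ge0 ?(ltW C0).
have V0 x : 0 <= V x.
  by rewrite mulr_ge0 ?right_weight_ge0 ?(ltW C0).
have ms0 : measurable_fun [set: 'rV[R]_n] (fun x => s x <= 0).
  exact: measurable_fun_ler.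
have mU : measurable_fun [set: 'rV[R]_n] U.
  apply: measurable_funM => //; apply: measurable_fun_ifT => //.
  exact: measurable_funM.
have mV : measurable_fun [set: 'rV[R]_n] V.
  apply: measurable_funM => //; apply: measurable_fun_ifT => //.
  exact: measurable_funM.
have mshift : measurable_fun [set: 'rV[R]_n] (fun x => x + z).
  exact: measurable_funD_rV.
have mUE : measurable_fun [set: 'rV[R]_n] (EFin \o U) by exact/measurable_EFinP.
have mVE : measurable_fun [set: 'rV[R]_n] (EFin \o V) by exact/measurable_EFinP.
have mVs : measurable_fun [set: 'rV[R]_n] (fun x => (V (x + z)%R)%:E).
  exact: (measurableT_comp mVE).
(* the total payment is the total budget *)
have E : (C%:E * directional_moment r m z =
    \int[L]_x (U x + V (x + z)%R)%:E)%E.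
  under [RHS]eq_integral do rewrite EFinD.
  rewrite ge0_integralD//; last 2 first.
    by move=> x _; rewrite lee_fin.
    by move=> x _; rewrite lee_fin.
  rewrite (ge0_integral_rV_translation z mVE); last by move=> x; rewrite lee_fin.
  rewrite -ge0_integralD//; last 2 first.
    by move=> x _; rewrite lee_fin.
    by move=> x _; rewrite lee_fin.
  rewrite -ge0_integralZl//; last 3 first.
    by apply/measurable_EFinP; exact: measurable_funM.
    by move=> x _; rewrite lee_fin mulr_ge0 ?powR_ge0.
    by rewrite lee_fin ltW.
  apply: eq_integral => x _; rewrite -EFinM -EFinD /U /V -mulrDl weightsD.
  by rewrite mulrA.
have [s0 hs0] := edge_weights a0 b0 r2.
rewrite E; apply: ge0_lt_integral.
- apply/measurable_EFinP/measurable_minr; apply: measurable_funM => //.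
  exact: (measurableT_comp mpi).
- by under eq_fun do rewrite EFinD; exact: emeasurable_funD.
- by move=> x; rewrite lee_fin le_min !mulr_ge0 ?(ltW a0) ?(ltW b0).
- by move=> x; rewrite lee_fin addr_ge0.
- move=> x; rewrite lee_fin; have [ge1 _] := hs0 (s x).
  apply: min_le_weights => //; rewrite ?left_weight_ge0 ?right_weight_ge0 ?(ltW C0)//.
  by rewrite sD.
- apply: negligibleS (negligible_coordv s0 (- m) z0) => x/=.
  apply: contra_notP => /eqP ss0 FN0; rewrite lte_fin.
  apply: min_lt_weights => //; rewrite ?left_weight_ge0 ?right_weight_ge0 ?(ltW C0)//.
    by rewrite sD; apply: (hs0 (s x)).2.
- rewrite -E mule_gt0 ?lte_fin//=.
  rewrite lte_mul_pinfty// ?lee_fin ?(ltW C0)//.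
Qed.

End flow.

(** * The joint law of two consecutive states *)

Lemma indic_setX (R : pzRingType) (T1 T2 : Type) (A : set T1) (B : set T2)
    (u : T1 * T2) : \1_(A `*` B) u = \1_A u.1 * \1_B u.2 :> R.
Proof. by rewrite !indicE -natrM mulnb in_setX. Qed.

Section joint_law.
Context {R : realType} {n : nat}.
Variables (pi phi : 'rV[R]_n -> R).
Hypotheses (mpi : measurable_fun [set: 'rV[R]_n] pi) (pi0 : forall x, 0 <= pi x).
Hypotheses (mphi : measurable_fun [set: 'rV[R]_n] phi)
  (phi0 : forall x, 0 <= phi x).
Local Notation L := (@lebesgue_rV R n).
Local Notation E := 'rV[R]_n.

Let prop (u : E * E) := pi u.1 * phi (u.2 - u.1).
Let prop0 u : 0 <= prop u.
Proof. by rewrite mulr_ge0. Qed.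

Let acc (u : E * E) := mh_acceptance pi phi u.1 u.2.

Lemma mh_acceptance_itv x y : 0 <= mh_acceptance pi phi x y <= 1.
Proof.
rewrite /mh_acceptance; case: ifP => _; last by rewrite ler01 lexx.
by rewrite le_min ler01 ge_min lexx divr_ge0 // mulr_ge0 // /rw_proposal.
Qed.

(** Detailed balance: the flux is symmetric in [x] and [y]. *)
Lemma mh_acceptance_flux x y : pi x * rw_proposal phi x y * mh_acceptance pi phi x y =
  Num.min (pi x * phi (y - x)) (pi y * phi (x - y)).
Proof.
rewrite /mh_acceptance /rw_proposal.
set p := pi x * _; set q := pi y * _.
have p0 : 0 <= p by exact: mulr_ge0.
have q0 : 0 <= q by exact: mulr_ge0.
case: ifPn => [p_gt0|]; first by rewrite minr_pMr// mulr1 mulrC divfK ?gt_eqF.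
rewrite -leNgt => p_le0; have -> : p = 0 by apply/eqP; rewrite eq_le p_le0.
by rewrite mul0r; apply/esym/min_idPl.
Qed.

Let msub : measurable_fun [set: E * E] (fun u : E * E => u.2 - u.1).
Proof. by apply: measurable_funD_rV => //; exact: measurable_funN_rV. Qed.

Let msubN : measurable_fun [set: E * E] (fun u : E * E => u.1 - u.2).
Proof. by apply: measurable_funD_rV => //; exact: measurable_funN_rV. Qed.

Let mprop : measurable_fun [set: E * E] prop.
Proof.
apply: measurable_funM; first exact: (measurableT_comp mpi).
exact: (measurableT_comp mphi).
Qed.

Let mprop_rev : measurable_fun [set: E * E] (fun u => pi u.2 * phi (u.1 - u.2)).
Proof.
apply: measurable_funM; first exact: (measurableT_comp mpi).
exact: (measurableT_comp mphi).
Qed.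

Let macc : measurable_fun [set: E * E] acc.
Proof.
apply: measurable_fun_ifT => //; first exact: measurable_fun_ltr.
apply: measurable_minr => //.
apply: measurable_funM => //.
(* inversion is measurable as a real power of the nonnegative [prop] *)
rewrite (_ : (fun u => _) = fun u => prop u `^ (- 1)); last first.
  by apply/funext => u; rewrite (powR_inv1 (prop0 u)).
by apply: (measurableT_comp (measurable_powR _)).
Qed.

Let move u := prop u * acc u.
Let stay u := prop u * (1 - acc u).

Let mmove : measurable_fun [set: E * E] move.
Proof. exact: measurable_funM. Qed.

Let mstay : measurable_fun [set: E * E] stay.
Proof. by apply: measurable_funM => //; exact: measurable_funB. Qed.

Let move0 u : 0 <= move u.
Proof. by have /andP[? _] := mh_acceptance_itv u.1 u.2; rewrite mulr_ge0. Qed.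

Let stay0 u : 0 <= stay u.
Proof. by have /andP[_ ?] := mh_acceptance_itv u.1 u.2; rewrite mulr_ge0// subr_ge0. Qed.

Let diag (u : E * E) : E * E := (u.1, u.1).

Let mdiag : measurable_fun [set: E * E] diag.
Proof. exact: measurable_fun_pair. Qed.

Local Notation L2 := (L \x L)%E.

(** The rejected proposals, which charge the diagonal. *)
Definition rwmh_staying : {measure set (E * E) -> \bar R}.
Proof. refine (pushforward (density L2 mstay stay0) diag); exact: mdiag. Defined.

Definition rwmh_joint : set (E * E) -> \bar R :=
  measure_add (density L2 mmove move0) rwmh_staying.

HB.instance Definition _ := Measure.on rwmh_joint.

Let integrand (B : set E) (u : E * E) :=
  phi (u.2 - u.1) * (acc u * \1_B u.2 + (1 - acc u) * \1_B u.1).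

Let mintegrand B : measurable B -> measurable_fun [set: E * E] (integrand B).
Proof.
move=> mB; have mB1 : measurable_fun [set: E] (\1_B : E -> R).
  exact: measurable_indic.
apply: measurable_funM; first exact: (measurableT_comp mphi).
apply: measurable_funD; apply: measurable_funM => //.
- exact: (measurableT_comp mB1).
- exact: measurable_funB.
- exact: (measurableT_comp mB1).
Qed.

Let integrand0 B u : 0 <= integrand B u.
Proof.
have /andP[a0 a1] := mh_acceptance_itv u.1 u.2.
by rewrite mulr_ge0// addr_ge0// mulr_ge0// subr_ge0.
Qed.

Let kernelE x B : rwmh_kernel pi phi x B = (\int[L]_y (integrand B (x, y))%:E)%E.
Proof. by []. Qed.

Let mkernel B : measurable B ->
  measurable_fun [set: E] (fun x => rwmh_kernel pi phi x B).
Proof.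
move=> mB.
apply: (measurable_fun_fubini_tonelli_F (EFin \o integrand B)).
  by apply/measurable_EFinP; exact: mintegrand.
by move=> u; rewrite lee_fin.
Qed.

Let kernel0 x B : (0 <= rwmh_kernel pi phi x B)%E.
Proof. by apply: integral_ge0 => y _; rewrite lee_fin (integrand0 B (x, y)). Qed.

Lemma rwmh_joint_rectangle A B : measurable A -> measurable B ->
  rwmh_joint (A `*` B) =
  (\int[L]_(x in A) ((pi x)%:E * rwmh_kernel pi phi x B))%E.
Proof.
move=> mA mB.
have mA1 : measurable_fun [set: E] (\1_A : E -> R) by exact: measurable_indic.
have mB1 : measurable_fun [set: E] (\1_B : E -> R) by exact: measurable_indic.
rewrite /rwmh_joint measure_addE.
transitivity (\int[L2]_u (\1_A u.1 * (move u * \1_B u.2))%:E +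
    \int[L2]_u (\1_A u.1 * (stay u * \1_B u.1))%:E)%E.
  congr (_ + _)%E.
    rewrite /= /density integral_mkcond; apply: eq_integral => u _.
    by rewrite epatch_indic /= -EFinM indic_setX /=; congr EFin; ring.
  rewrite /= /pushforward /density integral_mkcond.
  apply: eq_integral => u _; rewrite epatch_indic /= -EFinM; congr EFin.
  by rewrite -[\1_ _ u]/(\1_(A `*` B) (diag u)) indic_setX/=; ring.
rewrite -ge0_integralD//; last 4 first.
- by move=> u _; rewrite lee_fin mulr_ge0// mulr_ge0//.
- apply/measurable_EFinP; apply: measurable_funM; first exact: (measurableT_comp mA1).
  by apply: measurable_funM => //; exact: (measurableT_comp mB1).
- by move=> u _; rewrite lee_fin mulr_ge0// mulr_ge0//.
- apply/measurable_EFinP; apply: measurable_funM; first exact: (measurableT_comp mA1).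
  by apply: measurable_funM => //; exact: (measurableT_comp mB1).
transitivity (\int[L2]_u (\1_A u.1 * (pi u.1 * integrand B u))%:E)%E.
  apply: eq_integral => u _; rewrite -EFinD; congr EFin.
  by rewrite /move /stay /prop /integrand; ring.
have mI := mintegrand mB.
rewrite fubini_tonelli1/=; last 2 first.
- apply/measurable_EFinP; apply: measurable_funM; first exact: (measurableT_comp mA1).
  by apply: measurable_funM => //; exact: (measurableT_comp mpi).
- by move=> u; rewrite lee_fin mulr_ge0// mulr_ge0// integrand0.
rewrite [RHS]integral_mkcond; apply: eq_integral => x _.
rewrite epatch_indic /fubini_F kernelE /= muleAC -EFinM -ge0_integralZl//.
- by apply: eq_integral => y _; rewrite -EFinM; congr EFin; ring.
- by apply/measurable_EFinP; exact: (measurable_fun_pair2 x mI).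
- by move=> y _; rewrite lee_fin integrand0.
- by rewrite lee_fin mulr_ge0.
Qed.

Lemma ge0_integral_rwmh_joint (h : E * E -> \bar R) :
  measurable_fun [set: E * E] h -> (forall u, 0 <= h u)%E ->
  (forall x, h (x, x) = 0%E) ->
  (\int[rwmh_joint]_u h u = \int[L]_x \int[L]_y
    ((Num.min (pi x * phi (y - x)) (pi y * phi (x - y)))%R%:E * h (x, y)))%E.
Proof.
move=> mh h0 hdiag.
rewrite ge0_integral_measure_add// ge0_integral_density//.
rewrite [X in (_ + X)%E](_ : _ = 0%E) ?adde0; last first.
  rewrite /rwmh_staying /= ge0_integral_pushforward//.
  by apply: integral0_eq => u _ /=; exact: hdiag.
rewrite fubini_tonelli1/=; last 2 first.
- by apply: emeasurable_funM => //; exact/measurable_EFinP.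
- by move=> u; rewrite mule_ge0// lee_fin.
apply: eq_integral => x _; apply: eq_integral => y _.
by rewrite /move /prop /acc/= -mh_acceptance_flux.
Qed.

Context (dT : measure_display) (T : measurableType dT) (P : probability T R).
Variable X : nat -> {RV P >-> E}.
Hypothesis hX : stationary_rwmh pi phi X.

Lemma ge0_integral_stationary (f : E -> \bar R) :
  measurable_fun [set: E] f -> (forall x, 0 <= f x)%E ->
  (\int[P]_w f (X 0%N w) = \int[L]_x ((pi x)%:E * f x))%E.
Proof.
move=> mf f0; rewrite -(ge0_integral_density L mpi pi0)//.
rewrite -ge0_integral_distribution//; apply: eq_measure_integral => A mA _.
exact: hX.1.
Qed.

(** Rectangles generate the product sigma-algebra and are stable under
    intersection, so the Markov property determines the law of (X_0, X_1). *)
Lemma ge0_integral_rwmh_step (h : E * E -> \bar R) :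
  measurable_fun [set: E * E] h -> (forall u, 0 <= h u)%E ->
  (\int[P]_w h (X 0%N w, X 1%N w) = \int[rwmh_joint]_u h u)%E.
Proof.
move=> mh h0.
pose W w := (X 0%N w, X 1%N w).
have mW : measurable_fun [set: T] W by exact: measurable_fun_pair.
pose Wm : {mfun T >-> (E * E)%type} :=
  HB.pack W (isMeasurableFun.Build _ _ _ _ _ mW).
transitivity (\int[distribution P Wm]_u h u)%E.
  by rewrite ge0_integral_distribution.
apply: eq_measure_integral => S mS _.
pose C : set (set (E * E)) :=
  [set A `*` B | A in measurable & B in measurable].
apply: (measure_unique C (fun=> setT)) => //.
- exact: measurable_prod_measurableType.
- move=> _ _ [A1 mA1 [B1 mB1 <-]] [A2 mA2 [B2 mB2 <-]].
  rewrite -setXI; exists (A1 `&` A2); first exact: measurableI.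
  by exists (B1 `&` B2) => //; exact: measurableI.
- by move=> _; exists setT => //; exists setT => //; rewrite setXTT.
- by rewrite bigcup_const.
- move=> _ [A mA [B mB <-]] /=; rewrite rwmh_joint_rectangle//.
  rewrite /distribution /pushforward.
  transitivity (P (X 0%N @^-1` A `&` X 1%N @^-1` B)); first by congr (P _).
  rewrite (hX.2 0%N)//; last first.
    by apply: sub_sigma_algebra; exists 0%N => //=; exists A => //; rewrite setTI.
  rewrite integral_mkcond.
  transitivity (\int[P]_w ((fun x => rwmh_kernel pi phi x B) \_ A) (X 0%N w))%E.
    by apply: eq_integral => w _; rewrite /patch.
  rewrite ge0_integral_stationary; last 2 first.
  + by apply/(measurable_restrictT _ _).1 => //; apply: measurable_funTS; exact: mkernel.
  + by move=> x; rewrite /patch; case: ifP.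
  rewrite [RHS]integral_mkcond; apply: eq_integral => x _.
  by rewrite /patch; case: ifP => // _; rewrite mule0.
- by move=> _; exact: le_lt_trans (probability_le1 _ _) (ltry _).
Qed.

End joint_law.

(** * Integration over the increment *)

Section jump.
Context {R : realType} {n : nat}.
Variables (pi phi : 'rV[R]_n -> R).
Hypotheses (hpi : is_density pi) (hphi : is_density phi) (n1 : (1 <= n)%N).
Variables (r : R) (r2 : 2 <= r).
Local Notation L := (@lebesgue_rV R n).
Implicit Types (x y z m : 'rV[R]_n).

Let mpi : measurable_fun [set: 'rV[R]_n] pi. Proof. by case: hpi. Qed.
Let pi0 x : 0 <= pi x. Proof. by case: hpi. Qed.
Let ipi : (\int[L]_x (pi x)%:E = 1)%E. Proof. by case: hpi. Qed.
Let mphi : measurable_fun [set: 'rV[R]_n] phi. Proof. by case: hphi. Qed.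
Let phi0 x : 0 <= phi x. Proof. by case: hphi. Qed.
Let iphi : (\int[L]_x (phi x)%:E = 1)%E. Proof. by case: hphi. Qed.

Let r_neq0 : r != 0. Proof. by rewrite gt_eqF// (lt_le_trans _ r2). Qed.

Definition moment m : \bar R :=
  (\int[L]_x (euclidean_norm (x - m) `^ r * pi x)%:E)%E.

Let mshift m : measurable_fun [set: 'rV[R]_n] (fun x => x + m).
Proof. exact: measurable_funD_rV. Qed.

Let mnorm m : measurable_fun [set: 'rV[R]_n] (fun x => euclidean_norm (x - m) `^ r).
Proof. exact: measurable_euclidean_norm_powR. Qed.

Lemma moment_ge_coordv m z : z != 0 ->
  ((euclidean_norm z `^ r)%:E *
    directional_moment pi r m z <= moment m)%E.
Proof.
move=> z0.
have mc : measurable_fun [set: 'rV[R]_n]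
    (fun x => `|coordv (x - m) z| `^ r * pi x).
  apply: measurable_funM => //; apply: (measurableT_comp (measurable_powR _)).
  apply: measurableT_comp => //; exact: (measurableT_comp (measurable_coordv _)).
rewrite /directional_moment -ge0_integralZl//; last 3 first.
- exact/measurable_EFinP.
- by move=> x _; rewrite lee_fin mulr_ge0 ?powR_ge0.
- by rewrite lee_fin powR_ge0.
apply: ge0_le_integral => //.
- by move=> x _; rewrite -EFinM lee_fin !mulr_ge0 ?powR_ge0.
- by apply: emeasurable_funM => //; exact/measurable_EFinP.
- by apply/measurable_EFinP; exact: measurable_funM.
move=> x _; rewrite -EFinM lee_fin mulrA ler_wpM2r//.
rewrite -powRM ?euclidean_norm_ge0//; apply: ge0_ler_powR.
- by rewrite (le_trans _ r2).
- by rewrite nnegrE mulr_ge0 ?euclidean_norm_ge0.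
- by rewrite nnegrE euclidean_norm_ge0.
- exact: coordv_le_norm.
Qed.

(** In dimension 0 the moment is 0, and with it both sides of the theorem. *)
Lemma moment_gt0 m : (0 < moment m)%E.
Proof.
have e0 : const_mx 1 != 0 :> 'rV[R]_n.
  apply/eqP => /rowP /(_ (Ordinal n1)); rewrite !mxE => /eqP.
  by rewrite oner_eq0.
apply: lt_le_trans (moment_ge_coordv m e0).
by rewrite mule_gt0 ?directional_moment_gt0// lte_fin powR_gt0 ?euclidean_norm_gt0.
Qed.

Lemma pair_flow_ge0 a b z : 0 <= a -> 0 <= b -> (0 <= pair_flow pi a b z)%E.
Proof.
by move=> a0 b0; apply: integral_ge0 => x _; rewrite lee_fin le_min !mulr_ge0.
Qed.

Lemma pair_flow_eq0 a b z : 0 <= a -> 0 <= b -> a = 0 \/ b = 0 ->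
  pair_flow pi a b z = 0%E.
Proof.
move=> a0 b0 ab; apply: integral0_eq => x _; congr EFin; apply/eqP.
rewrite eq_le le_min !mulr_ge0// andbT ge_min.
by case: ab => ->; rewrite mul0r lexx ?orbT.
Qed.

(** The case left out of [pair_flow_lt], where a factor vanishes, is strict for a
    different reason: the left-hand side is 0 and the moment is positive. *)
Lemma pair_flow_moment_lt a b z m : 0 <= a -> 0 <= b -> 0 < a + b ->
  (moment m < +oo)%E ->
  ((euclidean_norm z `^ r)%:E * pair_flow pi a b z <
   ((a + b) * (2 `^ r / 4))%:E * moment m)%E.
Proof.
move=> a0 b0 ab Moo; set C := (a + b) * _.
have C0 : 0 < C by rewrite mulr_gt0// divr_gt0 ?powR_gt0.
have rhs0 : (0 < C%:E * moment m)%E by rewrite mule_gt0 ?moment_gt0.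
have [->|z0] := eqVneq z 0.
  by rewrite euclidean_norm0 powR0// mul0e.
have [a_eq0|a_neq0] := eqVneq a 0.
  by rewrite pair_flow_eq0 ?mule0//; left.
have [b_eq0|b_neq0] := eqVneq b 0.
  by rewrite pair_flow_eq0 ?mule0//; right.
have Z0 : 0 < euclidean_norm z `^ r by rewrite powR_gt0 ?euclidean_norm_gt0.
have le_mom := moment_ge_coordv m z0.
have Mzoo : (directional_moment pi r m z < +oo)%E.
  rewrite ltNge leye_eq; apply/eqP => E.
  by move: le_mom; rewrite E gt0_muley ?lte_fin// leye_eq => /eqP E'; rewrite E' in Moo.
have a_gt0 : 0 < a by rewrite lt_def a_neq0.
have b_gt0 : 0 < b by rewrite lt_def b_neq0.
apply: (@lt_le_trans _ _ (C%:E * ((euclidean_norm z `^ r)%:E *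
    directional_moment pi r m z))%E); last first.
  by rewrite lee_wpmul2l// lee_fin ltW.
have fin : (euclidean_norm z `^ r)%:E \is a fin_num by [].
rewrite muleCA (lte_pmul2l fin); first exact: pair_flow_lt.
by rewrite lte_fin.
Qed.

(** The expected r-th power of the length of a jump; staying put contributes
    nothing. *)
Definition jump_moment : \bar R :=
  (\int[L]_z ((euclidean_norm z `^ r)%:E * pair_flow pi (phi z) (phi (- z)%R) z))%E.

Let mflow : measurable_fun [set: 'rV[R]_n * 'rV[R]_n]
  (fun u => Num.min (phi u.1 * pi u.2) (phi (- u.1) * pi (u.2 + u.1))).
Proof.
apply: measurable_minr; apply: measurable_funM.
- exact: (measurableT_comp mphi).
- exact: (measurableT_comp mpi).
- by apply: (measurableT_comp mphi); exact: measurable_funN_rV.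
- by apply: (measurableT_comp mpi); exact: measurable_funD_rV.
Qed.

Lemma jump_moment_lt m : (moment m < +oo)%E ->
  (jump_moment < (2 `^ (r - 1))%:E * moment m)%E.
Proof.
move=> Moo.
have M0 := moment_gt0 m.
have K0 : 0 < 2 `^ r / 4 :> R by rewrite divr_gt0 ?powR_gt0.
have mphiN : measurable_fun [set: 'rV[R]_n] (fun z => phi (- z)).
  by apply: (measurableT_comp mphi); exact: measurable_funN_rV.
pose bound z := (((phi z + phi (- z)) * (2 `^ r / 4))%:E * moment m)%E.
have ibound : (\int[L]_z bound z = (2 `^ (r - 1))%:E * moment m)%E.
  rewrite ge0_integralZr//; last 3 first.
  - by apply/measurable_EFinP/measurable_funM => //; exact: measurable_funD.
  - by move=> z _; rewrite lee_fin mulr_ge0 ?addr_ge0// ltW.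
  - exact: ltW.
  congr (_ * _)%E; under eq_integral do rewrite mulrC EFinM EFinD.
  rewrite ge0_integralZl//; last 2 first.
  - by apply: emeasurable_funD; exact/measurable_EFinP.
  - by move=> z _; rewrite -EFinD lee_fin addr_ge0.
  rewrite ge0_integralD//; last 4 first.
  - by move=> z _; rewrite lee_fin.
  - exact/measurable_EFinP.
  - by move=> z _; rewrite lee_fin.
  - exact/measurable_EFinP.
  have iphiN : (\int[L]_z (phi (- z)%R)%:E = 1)%E.
    rewrite -[RHS]iphi -[RHS](@ge0_integral_rV_reflection R n 0 (EFin \o phi)).
    - by apply: eq_integral => z _ /=; rewrite sub0r.
    - exact/measurable_EFinP.
    - by move=> z; rewrite lee_fin.
  rewrite iphi iphiN -EFinD -EFinM; congr EFin.
  rewrite powRB ?powRr1//; last by rewrite pnatr_eq0 implybT.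
  by field.
rewrite -ibound; apply: ge0_lt_integral.
- apply: emeasurable_funM.
    apply/measurable_EFinP; have := mnorm 0.
    by under eq_fun do rewrite subr0.
  apply: (measurable_fun_fubini_tonelli_F (fun u : 'rV[R]_n * 'rV[R]_n =>
    (Num.min (phi u.1 * pi u.2) (phi (- u.1) * pi (u.2 + u.1)))%:E)).
    exact/measurable_EFinP.
  by move=> u; rewrite lee_fin le_min !mulr_ge0.
- apply: emeasurable_funM => //; apply/measurable_EFinP/measurable_funM => //.
  exact: measurable_funD.
- by move=> z; rewrite mule_ge0 ?lee_fin ?powR_ge0 ?pair_flow_ge0.
- by move=> z; rewrite mule_ge0 ?(ltW M0)// lee_fin mulr_ge0 ?addr_ge0// ltW.
- move=> z; have [phiz|] := ltP 0 (phi z + phi (- z)).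
    exact/ltW/pair_flow_moment_lt.
  move=> phiz.
  have /eqP : phi z + phi (- z) == 0 by rewrite eq_le phiz addr_ge0.
  rewrite /bound => E; rewrite E mul0r mul0e pair_flow_eq0 ?mule0//.
  by left; apply/eqP; rewrite eq_le phi0 andbT (le_trans _ phiz)// lerDl.
- apply: aeW => z; rewrite /bound => bz.
  apply: pair_flow_moment_lt => //; rewrite lt_def addr_ge0// andbT.
  by apply: contraNneq bz => ->; rewrite mul0r mul0e.
- rewrite ibound mule_gt0 ?lte_fin ?powR_gt0//=.
  by rewrite lte_mul_pinfty// ?lee_fin ?powR_ge0.
Qed.

Context (dT : measure_display) (T : measurableType dT) (P : probability T R).
Variable X : nat -> {RV P >-> 'rV[R]_n}.
Hypothesis hX : stationary_rwmh pi phi X.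

Lemma expectation_moment m :
  ('E_P[fun w => (euclidean_norm (X 0%N w - m) `^ r)%R] = moment m)%E.
Proof.
rewrite unlock (ge0_integral_stationary mpi pi0 hX
  (f := fun x => (euclidean_norm (x - m) `^ r)%:E)).
- by apply: eq_integral => x _; rewrite -EFinM mulrC.
- exact/measurable_EFinP.
- by move=> x; rewrite lee_fin powR_ge0.
Qed.

(** The density of (X_0, X_1) off the diagonal, in the variables [x] and
    [z = y - x]. *)
Lemma expectation_jump :
  ('E_P[fun w => (euclidean_norm (X 1%N w - X 0%N w) `^ r)%R] = jump_moment)%E.
Proof.
pose h (u : 'rV[R]_n * 'rV[R]_n) : \bar R := (euclidean_norm (u.2 - u.1) `^ r)%:E.
have mh : measurable_fun [set: 'rV[R]_n * 'rV[R]_n] h.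
  apply/measurable_EFinP/measurable_euclidean_norm_powR.
  by apply: measurable_funD_rV => //; exact: measurable_funN_rV.
have h0 u : (0 <= h u)%E by rewrite lee_fin powR_ge0.
rewrite unlock (ge0_integral_rwmh_step mpi pi0 mphi phi0 hX mh)//.
rewrite ge0_integral_rwmh_joint//; last first.
  by move=> x; rewrite /h subrr euclidean_norm0 powR0.
pose F (u : 'rV[R]_n * 'rV[R]_n) : \bar R := ((euclidean_norm u.1 `^ r) *
  Num.min (phi u.1 * pi u.2) (phi (- u.1) * pi (u.2 + u.1)))%:E.
have mF : measurable_fun [set: 'rV[R]_n * 'rV[R]_n] F.
  apply/measurable_EFinP; apply: measurable_funM => //.
  exact: measurable_euclidean_norm_powR.
have F0 u : (0 <= F u)%E.
  by rewrite lee_fin mulr_ge0 ?powR_ge0// le_min !mulr_ge0.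
transitivity (\int[L]_x \int[L]_z F (z, x))%E.
  apply: eq_integral => x _.
  rewrite -(ge0_integral_rV_translation x).
  - apply: eq_integral => z _; rewrite /F /h /= addrK -EFinM.
    have -> : x - (z + x) = - z by rewrite opprD addrCA subrr addr0.
    rewrite [x + z]addrC; congr EFin; rewrite [RHS]mulrC.
    by congr (Num.min _ _ * _); exact: mulrC.
  - apply: emeasurable_funM; last exact: (measurable_fun_pair2 x mh).
    apply/measurable_EFinP/measurable_minr; apply: measurable_funM => //.
      exact: (measurableT_comp mphi).
    apply: (measurableT_comp mphi); apply: measurable_funD_rV => //.
    exact: measurable_funN_rV.
  - by move=> y; rewrite mule_ge0// lee_fin le_min !mulr_ge0.
rewrite -(fubini_tonelli F)//.
apply: eq_integral => z _; rewrite /pair_flow -ge0_integralZl//.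
- by apply/measurable_EFinP; exact: (measurable_fun_pair2 z mflow).
- by move=> x _; rewrite lee_fin le_min !mulr_ge0.
- by rewrite lee_fin powR_ge0.
Qed.

End jump.

Theorem theorem2p1 (R : realType) (d : nat) (hd : (1 <= d)%N)
    (r : R) (hr : 2 <= r)
    (pi phi : 'rV[R]_d -> R) (hpi : is_density pi) (hphi : is_density phi)
    (dT : measure_display) (T : measurableType dT) (P : probability T R)
    (X : nat -> {RV P >-> 'rV[R]_d}) (hX : stationary_rwmh pi phi X)
    (hXr : ('E_P[fun w => (euclidean_norm (X 0%N w) `^ r)%R] < +oo)%E)
    (m : 'rV[R]_d) :
  ('E_P[fun w => (euclidean_norm (X 1%N w - X 0%N w) `^ r)%R] <
   (2 `^ (r - 1))%:E *
   'E_P[fun w => (euclidean_norm (X 0%N w - m) `^ r)%R])%E.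
Proof.
rewrite (expectation_moment hpi r hX) (expectation_jump hpi hphi hr hX).
have [Moo|] := ltP (moment pi r m) +oo%E; first exact: jump_moment_lt.
(* the moment about m is infinite, but the one about 0 is not *)
have M0oo : (moment pi r 0 < +oo)%E.
  rewrite -(expectation_moment hpi r hX).
  by under eq_fun do rewrite subr0.
rewrite leye_eq => /eqP ->; rewrite gt0_muley ?lte_fin ?powR_gt0//.
apply: lt_trans (jump_moment_lt hpi hphi hd hr M0oo) _.
by rewrite lte_mul_pinfty// ?lee_fin ?powR_ge0// ge0_fin_numE// ltW// moment_gt0.
Qed.
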